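(* Let $X$ and $Y$ be independent and identically distributed random variables with absolutely continuous distribution function $F$ on $\mathbb{R}$, and let $\psi:\mathbb{R}\to\mathbb{R}$ be a measurable function with $E_F(\psi(X))=0$. Then the inequality $$E_F\Big(\big[E_F\big(\psi(Y)\mathbf 1_{[Y<X]}\mid X\big)\big]^2\Big)\le\frac1{\pi^2}\,E_F\big(\psi^2(X)\big)$$ holds, with equality if and only if $\psi$ is $F$-almost everywhere equal to a constant times $\cos(\pi F)$, i.e. there is a constant $a\in\mathbb{R}$ with $\psi(x)=a\cos(\pi F(x))$ for $F$-almost every $x$.
   Context: The distribution function is $F(x)=P_F(X\le x)$, $x\in\mathbb{R}$; $E_F$ denotes expectation when the random variables have distribution function $F$. Absolute continuity means that $F$ has a density with respect to Lebesgue measure. $\mathbf 1_{[\cdot]}$ denotes an indicator, and $E_F(\psi(Y)\mathbf 1_{[Y<X]}\mid X=x)=\int_{(-\infty,x)}\psi(y)\,dF(y)$. ''$F$-almost everywhere'' means almost everywhere with respect to the probability measure on $\mathbb{R}$ induced by $F$. *)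

(* Defs.v *)
From HB Require Import structures.
From mathcomp Require Import all_boot all_order all_algebra.
From mathcomp Require Import all_classical all_reals all_analysis.
From mathcomp Require Import measurable_realfun.

Set Implicit Arguments.
Unset Strict Implicit.
Unset Printing Implicit Defensive.

Import Order.TTheory GRing.Theory Num.Theory.
Import numFieldNormedType.Exports.

Local Open Scope classical_set_scope.
Local Open Scope ring_scope.

Definition independent_RV (d : measure_display) (T : measurableType d)
    (R : realType) (P : probability T R) (X Y : {RV P >-> R}) : Prop :=
  forall A B : set R, measurable A -> measurable B ->
    P (X @^-1` A `&` Y @^-1` B) = (P (X @^-1` A) * P (Y @^-1` B))%E.

Definition has_distribution_function (d : measure_display)
    (T : measurableType d) (R : realType) (P : probability T R)
    (X : {RV P >-> R}) (F : R -> R) : Prop :=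
  forall x : R, cdf X x = (F x)%:E.

Definition absolutely_continuous_df (R : realType) (F : R -> R) : Prop :=
  exists f : R -> R,
    [/\ measurable_fun [set: R] f,
        (forall x : R, 0 <= f x) &
        forall x : R,
          (F x)%:E = (\int[lebesgue_measure]_(t in `]-oo, x]) (f t)%:E)%E].

Definition sigma_of (d : measure_display) (T : measurableType d)
    (R : realType) (X : T -> R) : set_system T :=
  preimage_set_system [set: T] X (@measurable _ R).

(* Conditional expectations are unique only up to P-null sets, hence a
   relation: W is a version of E(Z | G), for a sub-sigma-algebra G. *)
Definition is_cond_expectation (d : measure_display) (T : measurableType d)
    (R : realType) (P : probability T R) (G : set_system T)
    (Z W : T -> R) : Prop :=
  [/\ (forall B : set R, measurable B -> G (W @^-1` B)),
      P.-integrable [set: T] (EFin \o W) &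
      forall A : set T, G A ->
        (\int[P]_(w in A) (W w)%:E = \int[P]_(w in A) (Z w)%:E)%E].

(* The function x |-> E(psi(Y) 1_[Y < X] | X = x), read as an integral over
   (-oo, x) against the law of Y, does give a version of this conditional
   expectation when X and Y are independent. *)
Lemma cond_expectation_lt (d : measure_display) (T : measurableType d)
    (R : realType) (P : probability T R) (X Y : {RV P >-> R}) (psi : R -> R) :
  independent_RV X Y ->
  measurable_fun [set: R] psi ->
  P.-integrable [set: T] (EFin \o (psi \o Y)) ->
  is_cond_expectation P (sigma_of X)
    (fun w => psi (Y w) * \1_[set v | Y v < X v] w)
    (fun w => \int[distribution P Y]_(y in `]-oo, X w[) psi y).
Proof.
move=> indep mpsi ipsi.
pose m1 := distribution P X; pose m2 := distribution P Y.
pose h (z : R * R) : \bar R := (psi z.2 * \1_[set u : R * R | u.2 < u.1] z)%:E.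
pose XY (w : T) : R * R := (X w, Y w).
have mXY : measurable_fun [set: T] XY by exact: measurable_fun_pair.
pose XYm : {mfun T >-> (R * R)%type} := HB.pack XY (isMeasurableFun.Build _ _ _ _ XY mXY).
have mlt : measurable [set u : R * R | u.2 < u.1].
  have := measurable_fun_ltr (measurable_snd : measurable_fun [set: R * R] _)
    (measurable_fst : measurable_fun [set: R * R] _).
  by move=> /(_ measurableT [set true] I); rewrite setTI.
have mh : measurable_fun [set: R * R] h.
  apply/measurable_EFinP; apply: measurable_funM.
    exact: measurableT_comp.
  exact: measurable_indic.
have le_h z : (`|h z| <= `|(psi z.2)%:E|)%E.
  rewrite lee_fin normrM ler_piMr ?normr_ge0//.
  by rewrite indicE; case: (_ \in _); rewrite ?normr1 ?normr0.
have ihP : P.-integrable [set: T] (h \o XY).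
  apply: le_integrable ipsi => //; first exact: measurableT_comp.
  by move=> w _; exact: le_h.
have ipsi2 : m2.-integrable [set: R] (EFin \o psi).
  apply: integrable_pushforward => //.
  exact/measurable_EFinP.
have joint (A : set (R * R)) : measurable A ->
    distribution P XYm A = (m1 \x m2)%E A.
  by move=> mA; apply/esym; apply: product_measure_unique.
have ih12 : (m1 \x m2)%E.-integrable [set: R * R] h.
  have /integrableP[_ hoo] : (distribution P XYm).-integrable [set: R * R] h.
    exact: integrable_pushforward.
  apply/integrableP; split => //.
  rewrite -(@eq_measure_integral _ _ _ _ _ (distribution P XYm))// => A mA _.
  exact: joint.
have hFE x : fubini_F m2 h x = (\int[m2]_(y in `]-oo, x[) psi y)%:E.
  rewrite /fubini_F /Rintegral fineK; last first.
    apply: integrable_fin_num => //.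
    exact: integrableS ipsi2.
  rewrite [RHS]integral_mkcond; apply: eq_integral => y _.
  rewrite /h patchE indicE.
  have -> : ((x, y) \in [set u : R * R | u.2 < u.1]) = (y < x).
    exact: asboolb.
  have -> : (y \in [set` `]-oo, x[]) = (y < x) by rewrite mem_setE in_itv.
  by case: ifPn => _; rewrite ?mulr1 ?mulr0.
pose g x := \int[m2]_(y in `]-oo, x[) psi y.
have mg : measurable_fun [set: R] g.
  apply/measurable_EFinP.
  rewrite (_ : EFin \o g = fubini_F m2 h).
    exact: measurable_fubini_F ih12.
  by apply/funext => x; rewrite hFE.
have igX : P.-integrable [set: T] (EFin \o (g \o X)).
  have /integrableP[_] := integrable_fubini_F ih12.
  rewrite /m1 /distribution ge0_integral_pushforward//; last first.
    apply: measurableT_comp => //; exact: measurable_fubini_F ih12.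
  rewrite preimage_setT => goo; apply/integrableP; split.
    by apply/measurable_EFinP; exact: measurableT_comp.
  apply: le_lt_trans goo; rewrite le_eqVlt; apply/orP; left; apply/eqP.
  by apply: eq_integral => w _ /=; rewrite hFE.
split => //.
- move=> B mB; exists (g @^-1` B); last by rewrite setTI.
  by rewrite -[X in measurable X]setTI; exact: mg.
- move=> _ [C mC <-]; rewrite setTI.
  have mXC : measurable (X @^-1` C) by exact: measurable_funPTI.
  have mCT : measurable (C `*` [set: R]) by exact: measurableX.
  transitivity (\int[m1]_(x in C) (g x)%:E)%E.
    rewrite /m1 /distribution integral_pushforward//.
      exact/measurable_EFinP.
    exact: (integrableS measurableT mXC (@subsetT _ _) igX).
  transitivity (\int[(m1 \x m2)%E]_(z in C `*` [set: R]) h z)%E.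
    rewrite [RHS]integral_mkcond -integral12_prod_meas1; last first.
      apply/(integrable_mkcond _ mCT).
      exact: (integrableS measurableT mCT (@subsetT _ _) ih12).
    rewrite integral_mkcond; apply: eq_integral => x _.
    rewrite /fubini_F patchE; case: ifPn => xC.
      rewrite -hFE; apply: eq_integral => y _.
      by rewrite patchE mem_set//; split => //=; exact: set_mem.
    rewrite integral0_eq// => y _; rewrite patchE memNset// => -[/= Cx _].
    by move: xC; rewrite mem_set.
  rewrite -(@eq_measure_integral _ _ _ _ _ (distribution P XYm)); last first.
    by move=> A mA _; exact: joint.
  have ihC : P.-integrable (XY @^-1` (C `*` [set: R])) (h \o XY).
    apply: (integrableS measurableT _ (@subsetT _ _) ihP).
    exact: (measurable_funPTI XYm mCT).
  rewrite [LHS](integral_pushforward mXY mh ihC mCT).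
  rewrite (_ : XY @^-1` _ = X @^-1` C)//.
  by apply/seteqP; split => w //= -[].
Qed.

(* Main.v *)
Require Import Defs.
From HB Require Import structures.
From mathcomp Require Import all_boot all_order all_algebra.
From mathcomp Require Import all_classical all_reals all_analysis.
From mathcomp Require Import measurable_realfun ring lra.
Import Order.TTheory GRing.Theory Num.Theory.
Import numFieldNormedType.Exports.
Set Implicit Arguments.
Unset Strict Implicit.
Unset Printing Implicit Defensive.
Local Open Scope classical_set_scope.
Local Open Scope ring_scope.

(** The inequality is Wirtinger's inequality on [0, 1] with Dirichlet boundary
    conditions, read through the variable U = F (X).

    An absolutely continuous F is continuous, so U is uniform on [0, 1]
    (probability_integral_transform), and up to a null set the event Y < X reads
    F (Y) < F (X). The conditional expectation is thus the function
    G (x) = the integral of psi over the points y with U (y) < U (x)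
    (integral_below), whose square is to be integrated.

    The proof treats the halves U < 1/2 and U > 1/2 separately and uses no
    derivative of G. On the lower half the weight w = cos (pi U) is positive, and
    the Cauchy-Schwarz inequality gives
      G (x) ^ 2 <= (integral of w below x) * (integral of psi ^ 2 / w below x),
    where the first factor is sin (pi U (x)) / pi. Integrating over x in the lower
    half and exchanging the integrals, psi (y) ^ 2 / w (y) gets multiplied by the
    integral of sin (pi U (x)) / pi over U (y) < U (x) < 1/2, that is by
    cos (pi U (y)) / pi ^ 2. The weight cancels and lower_half_le results: the
    inequality with the sharp constant, already on the lower half alone. Equality
    holds only if it holds in Cauchy-Schwarz for almost every x, which makes psi
    proportional to w below x, with a factor that cannot depend on x
    (lower_half_eq).

    The upper half is the lower half of 1 - U. Since psi has mean 0, the integral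
    above x is - G (x) (integral_belowC), so the same lemmas apply; mean 0 also
    forces the amplitudes of psi on the two halves to agree (uniform_eq).

    What remains is to see that every version of the conditional expectation is
    almost everywhere G (is_cond_expectation_unique), and that G is bounded, so
    that equality fails when psi is not square integrable, as it must because
    a cos (pi F) is bounded. *)

(** * Distribution functions and uniform random variables *)

(** The half-lines generate the Borel sets and are stable under intersection. *)
Lemma eq_probability_cdf (R : realType)
    (m1 m2 : probability (measurableTypeR R) R) :
  (forall x, m1 `]-oo, x]%classic = m2 `]-oo, x]%classic) ->
  forall A, measurable A -> m1 A = m2 A.
Proof.
move=> h A mA.
apply: (@measure_unique _ R (measurableTypeR R) (@RGenOInfty.G R)
  (fun k : nat => `](- k%:R), +oo[%classic) _ _ _ _ m1 m2) => //.
- exact: RGenOInfty.measurableE.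
- move=> _ _ [x ->] [y ->]; exists (Num.max x y).
  by apply/seteqP; split => z /=; rewrite !in_itv/= !andbT gt_max => /andP.
- by move=> k; exists (- k%:R).
- rewrite -subTset => x _; exists (Num.truncn `|x|).+1 => //=.
  rewrite in_itv/= andbT ltrNl (le_lt_trans (ler_norm _))// normrN.
  by rewrite Num.Theory.truncnS_gt.
- move=> _ [x ->].
  have e (m : probability (measurableTypeR R) R) :
      m `]x, +oo[%classic = (1 - m `]-oo, x]%classic)%E.
    by rewrite -setCitvl probability_setC.
  by rewrite [LHS]e [RHS]e h.
- by move=> k; rewrite (le_lt_trans (probability_le1 _ _)) ?ltry.
Qed.

(** On a segment [a, b] the function is F a plus the integral of the density from
    a, and an indefinite Lebesgue integral is continuous. *)
Lemma absolutely_continuous_df_continuous (R : realType) (F : R -> R) (a b : R) :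
  absolutely_continuous_df F -> a <= b ->
  {within `[a, b], continuous F}.
Proof.
move=> [f [mf f0 FE]] ab.
have intf x : (@lebesgue_measure R).-integrable `]-oo, x] (EFin \o f).
  apply/integrableP; split; first exact/measurable_EFinP/measurable_funTS.
  under eq_integral do rewrite /= ger0_norm//.
  by rewrite -FE ltry.
have intab : (@lebesgue_measure R).-integrable `[a, b] (EFin \o f).
  by apply: integrableS (intf b) => //; exact: subset_itvr.
have h := parameterized_integral_continuous ab intab.
have FaE x : x \in `[a, b] ->
    F x = F a + parameterized_integral lebesgue_measure a x f.
  rewrite in_itv/= => /andP[ax xb].
  rewrite /parameterized_integral; apply: EFin_inj; rewrite EFinD !FE.
  rewrite (@itv_bndbnd_setU _ _ _ (BRight a))// ge0_integral_setU//=.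
  - congr (_ + _)%E; rewrite integral_itv_obnd_cbnd; last first.
      exact/measurable_EFinP/measurable_funTS.
    rewrite fineK//; apply: integrable_fin_num => //.
    by apply: integrableS intab => //; exact: subset_itvl.
  - exact/measurable_EFinP/measurable_funTS.
  - by move=> z _; rewrite lee_fin.
  - apply/disj_set2P; rewrite -subset0 => z/=; rewrite !in_itv/= => -[za /andP[]].
    by rewrite ltNge za.
apply: (@subspace_eq_continuous _ _ _
  (fun x => F a + parameterized_integral lebesgue_measure a x f)).
  by move=> x; rewrite inE => /FaE.
by move=> x; apply: cvgD; [exact: cvg_cst|exact: h].
Qed.

(** Asking for both the strict and the large inequality makes the notion stable
    under u |-> 1 - u without an appeal to the absence of atoms, and having the
    values in [0, 1] everywhere spares almost-everywhere qualifications. *)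
Definition uniform01 (d : measure_display) (T : measurableType d)
    (R : realType) (P : probability T R) (U : T -> R) : Prop :=
  (forall x, 0 <= U x <= 1) /\
  forall u : R, 0 <= u <= 1 ->
    P [set x | U x < u] = u%:E /\ P [set x | U x <= u] = u%:E.

Lemma measurable_set_ltr d (T : measurableType d) (R : realType) (f g : T -> R) :
  measurable_fun setT f -> measurable_fun setT g ->
  measurable [set x | f x < g x].
Proof.
move=> mf mg; have := measurable_fun_ltr mf mg.
by move=> /(_ measurableT [set true] I); rewrite setTI.
Qed.

Lemma measurable_set_ler d (T : measurableType d) (R : realType) (f g : T -> R) :
  measurable_fun setT f -> measurable_fun setT g ->
  measurable [set x | f x <= g x].
Proof.
move=> mf mg; have := measurable_fun_ler mf mg.
by move=> /(_ measurableT [set true] I); rewrite setTI.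
Qed.

(** The reflection that exchanges the two halves of [0, 1]. *)
Lemma uniform01C d (T : measurableType d) (R : realType) (P : probability T R)
    (U : T -> R) : measurable_fun setT U ->
  uniform01 P U -> uniform01 P (fun x => 1 - U x).
Proof.
move=> mU [U01 Uu]; split.
  by move=> x; have := U01 x; lra.
move=> u u01; have /Uu[Pl Pr] : 0 <= 1 - u <= 1 by lra.
have -> : [set x | 1 - U x < u] = ~` [set x | U x <= 1 - u].
  by apply/seteqP; split=> x /= => [h|/negP]; [apply/negP|]; rewrite -ltNge; lra.
have -> : [set x | 1 - U x <= u] = ~` [set x | U x < 1 - u].
  by apply/seteqP; split=> x /= => [h|/negP]; [apply/negP|]; rewrite -leNgt; lra.
rewrite !probability_setC.
- by rewrite Pl Pr -EFinB subKr.
- exact: measurable_set_ltr.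
- exact: measurable_set_ler.
Qed.

(** For v strictly between 0 and 1 the intermediate value theorem gives t with
    F t = v. If v < u then X <= t implies F (X) < u, and if u < v then
    F (X) <= u implies X <= t; since X <= t has probability v, both
    probabilities are squeezed to u. *)
Lemma probability_integral_transform d (T : measurableType d) (R : realType)
    (P : probability T R) (X : {RV P >-> R}) (F : R -> R) :
  has_distribution_function X F ->
  (forall a b, a <= b -> {within `[a, b], continuous F}) ->
  uniform01 P (F \o X).
Proof.
move=> XF cF.
have F01 x : 0 <= F x <= 1.
  by rewrite -!lee_fin -XF cdf_ge0 cdf_le1.
have ndF : {homo F : x y / x <= y}.
  by move=> x y xy; rewrite -lee_fin -!XF cdf_nondecreasing.
have mF : measurable_fun setT F by exact: nondecreasing_measurable.
have mFX : measurable_fun setT (F \o X) by exact: measurableT_comp.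
have FE : fine \o cdf X = F by apply/funext => x /=; rewrite XF.
have FNy : F @ -oo --> (0 : R) by rewrite -FE; exact/fine_cvg/cvg_cdfNy0.
have Fy : F @ +oo --> (1 : R) by rewrite -FE; exact/fine_cvg/cvg_cdfy1.
have ivt v : 0 < v < 1 -> exists t, F t = v.
  move=> /andP[v0 v1].
  have [a Fa] : exists a, F a < v.
    by apply: (@filter_ex _ (-oo%R : set_system R)); exact: cvgr_lt FNy _ v0.
  have [b Fb] : exists b, v < F b.
    by apply: (@filter_ex _ (+oo%R : set_system R)); exact: cvgr_gt Fy _ v1.
  have ab : a <= b.
    by rewrite leNgt; apply/negP => /ltW /ndF; lra.
  have [|t _ <-] := IVT ab (cF _ _ ab) (v := v); last by exists t.
  by rewrite ge_min le_max (ltW Fa) (ltW Fb) orbT.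
have PX t : P [set x | X x <= t] = (F t)%:E by rewrite -XF.
have mX : measurable_fun setT (X : T -> R) by [].
have mlt u : measurable [set x | (F \o X) x < u] by exact: measurable_set_ltr.
have mle u : measurable [set x | (F \o X) x <= u] by exact: measurable_set_ler.
have mXle u : measurable [set x | X x <= u] by exact: measurable_set_ler.
split=> [x|u /andP[u0 u1]]; first exact: F01.
(* e is the gap between u and the level whose preimage t is used *)
have lo : (u%:E <= P [set x | ((F \o X) x < u)%R])%E.
  apply/lee_addgt0Pr => e e0; rewrite -leeBlDr// -EFinB.
  have [v0|v0] := leP (u - e) 0.
    by rewrite (@le_trans _ _ 0%E)// lee_fin.
  have [|t Ft] := ivt (u - e); first by lra.
  rewrite -Ft -PX le_measure ?inE// => x /= /ndF; lra.
have hi : (P [set x | ((F \o X) x <= u)%R] <= u%:E)%E.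
  apply/lee_addgt0Pr => e e0; rewrite -EFinD.
  have [v1|v1] := leP 1 (u + e).
    by rewrite (@le_trans _ _ 1%E)// ?probability_le1// lee_fin.
  have [|t Ft] := ivt (u + e); first by lra.
  rewrite -Ft -PX le_measure ?inE// => x /= Fxu.
  by rewrite leNgt; apply/negP => /ltW /ndF; lra.
have lh : (P [set x | ((F \o X) x < u)%R] <= P [set x | ((F \o X) x <= u)%R])%E.
  by rewrite le_measure ?inE// => x /= /ltW.
split; apply/eqP; rewrite eq_le.
  by rewrite lo (le_trans lh hi).
by rewrite hi (le_trans lo lh).
Qed.

(** * Integrals of trigonometric functions of a uniform variable *)

Lemma uniform_probE (R : realType) (A : set R) : measurable A ->
  uniform_prob (@ltr01 R) A = lebesgue_measure (A `&` `[0, 1]%classic).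
Proof.
move=> mA; rewrite /uniform_prob integral_uniform_pdf.
rewrite (eq_integral (cst 1%E)) => [|x].
  by rewrite integral_cst ?mul1e//; exact: measurableI.
by rewrite inE /uniform_pdf => -[_ /=]; rewrite in_itv/= => ->; rewrite subr0 invr1.
Qed.

(** The codomain is the Borel type of half-open intervals, on which the uniform
    probability is defined. *)
Lemma uniform01_law d (T : measurableType d) (R : realType)
    (P : probability T R) (U : {RV P >-> measurableTypeR R}) : uniform01 P U ->
  forall A, measurable A -> distribution P U A = uniform_prob (@ltr01 R) A.
Proof.
move=> [U01 Uu] A mA.
apply: (@eq_probability_cdf R (distribution P U) (uniform_prob (@ltr01 R)) _ A mA) => x.
rewrite [RHS]uniform_probE// -[LHS]/(P [set w | U w <= x]).
have [x0|x0] := ltP x 0.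
  rewrite (_ : _ `&` _ = set0) ?measure0; last first.
    by rewrite -subset0 => z/=; rewrite !in_itv/=; lra.
  rewrite (_ : [set _ | _] = set0) ?measure0//.
  rewrite -subset0 => z /= h.
  by have := U01 z; lra.
have [x1|x1] := leP x 1.
  rewrite (_ : _ `&` _ = `[0, x]%classic); last first.
    apply/seteqP; split => z/=; rewrite !in_itv/=.
      by move=> [zx /andP[-> _]].
    by move=> /andP[-> zx]; rewrite zx (le_trans zx).
  rewrite lebesgue_measure_itv/= lte_fin.
  have /Uu[_] : 0 <= x <= 1 by lra.
  move=> ->.
  by case: ltP => [_|h]; rewrite ?oppr0 ?sube0//; congr EFin; lra.
rewrite (_ : _ `&` _ = `[0, 1]%classic); last first.
  by apply/seteqP; split => z/=; rewrite !in_itv/=; lra.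
rewrite lebesgue_measure_itv/= lte_fin ltr01 sube0.
rewrite (_ : [set _ | _] = setT) ?probability_setT//.
by rewrite -subTset => z _ /=; have := U01 z; lra.
Qed.

(** Change of variables u = U x, restricted to a Borel subset of [0, 1]. *)
Lemma ge0_integral_uniform01 d (T : measurableType d) (R : realType)
    (P : probability T R) (U : T -> R) (D : set R) (f : R -> R) :
  measurable_fun setT U -> uniform01 P U ->
  measurable D -> D `<=` `[0, 1]%classic ->
  measurable_fun setT f -> (forall u, D u -> 0 <= f u) ->
  (\int[P]_(x in U @^-1` D) (f (U x))%:E =
   \int[lebesgue_measure]_(u in D) (f u)%:E)%E.
Proof.
move=> mU U01 mD D01 mf f0.
pose V : {RV P >-> measurableTypeR R} :=
  HB.pack U (isMeasurableFun.Build _ _ T (measurableTypeR R) U mU).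
pose g := (EFin \o f) \_ D.
have mg : measurable_fun setT g.
  by apply/(measurable_restrictT (EFin \o f) mD); exact/measurable_EFinP/measurable_funTS.
have g0 u : (0 <= g u)%E.
  by rewrite /g patchE; case: ifPn => // /[1!inE] /f0; rewrite lee_fin.
transitivity (\int[P]_x (g \o V) x)%E.
  by rewrite integral_mkcond; apply: eq_integral => x _; rewrite /g !patchE.
rewrite -ge0_integral_distribution//.
transitivity (\int[uniform_prob (@ltr01 R)]_x g x)%E.
  by apply: eq_measure_integral => A mA _; exact: uniform01_law.
rewrite integral_uniform// subr0 invr1 mul1e /g -integral_mkcondr.
by rewrite setIidr.
Qed.

Lemma integral_cos_pi (R : realType) (t : R) : 0 <= t ->
  (\int[lebesgue_measure]_(u in `[0%R, t]) (cos (pi * u))%:E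
   = (sin (pi * t) / pi)%:E)%E.
Proof.
rewrite le_eqVlt => /predU1P[<-|t0].
  by rewrite set_itv1 integral_set1 mulr0 sin0 mul0r.
have h (x : R) : is_derive x 1 (fun u => sin (pi * u) / pi) (cos (pi * x)).
  apply: is_derive_eq; rewrite /GRing.scale/=.
  by have := lt0r_neq0 (pi_gt0 R); move: (@pi R) => p p0; field.
have cF : continuous (fun u : R => sin (pi * u) / pi).
  by move=> x; apply: differentiable_continuous; apply/derivable1_diffP.
rewrite (@continuous_FTC2 _ _ (fun u => sin (pi * u) / pi))//.
- by rewrite mulr0 sin0 mul0r sube0.
- apply: continuous_subspaceT => x; apply: continuous_comp; last exact: continuous_cos.
  exact: mulrl_continuous.
- split.
  + by move=> x _; apply: ex_derive.
  + by apply: cvg_at_right_filter; exact: cF.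
  + by apply: cvg_at_left_filter; exact: cF.
- by move=> x _; rewrite derive1E; apply: derive_val.
Qed.

Lemma integral_sin_pi (R : realType) (s t : R) : s <= t ->
  (\int[lebesgue_measure]_(u in `[s, t]) (sin (pi * u))%:E
   = ((cos (pi * s) - cos (pi * t)) / pi)%:E)%E.
Proof.
rewrite le_eqVlt => /predU1P[<-|t0].
  by rewrite set_itv1 integral_set1 subrr mul0r.
have h (x : R) : is_derive x 1 (fun u => - cos (pi * u) / pi) (sin (pi * x)).
  apply: is_derive_eq; rewrite /GRing.scale/=.
  by have := lt0r_neq0 (pi_gt0 R); move: (@pi R) => p p0; field.
have cF : continuous (fun u : R => - cos (pi * u) / pi).
  by move=> x; apply: differentiable_continuous; apply/derivable1_diffP.
rewrite (@continuous_FTC2 _ _ (fun u => - cos (pi * u) / pi))//.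
- by rewrite -EFinB; congr EFin; ring.
- apply: continuous_subspaceT => x; apply: continuous_comp; last exact: continuous_sin.
  exact: mulrl_continuous.
- split.
  + by move=> x _; apply: ex_derive.
  + by apply: cvg_at_right_filter; exact: cF.
  + by apply: cvg_at_left_filter; exact: cF.
- by move=> x _; rewrite derive1E; apply: derive_val.
Qed.

Lemma measurable_cos_pi d (T : measurableType d) (R : realType) (U : T -> R) :
  measurable_fun setT U -> measurable_fun setT (fun x => cos (pi * U x)).
Proof.
move=> mU; apply: (measurableT_comp (f := @cos R)).
  by apply: continuous_measurable_fun; exact: continuous_cos.
exact: measurable_funM.
Qed.

Lemma measurable_sin_pi d (T : measurableType d) (R : realType) (U : T -> R) :
  measurable_fun setT U -> measurable_fun setT (fun x => sin (pi * U x)).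
Proof.
move=> mU; apply: (measurableT_comp (f := @sin R)).
  by apply: continuous_measurable_fun; exact: continuous_sin.
exact: measurable_funM.
Qed.

Lemma cos_pi_gt0 (R : realType) (u : R) : 0 <= u < 1/2 -> 0 < cos (pi * u).
Proof.
move=> u01; have p0 := pi_gt0 R; apply: cos_gt0_pihalf.
by apply/andP; split; nra.
Qed.

Lemma sin_pi_gt0 (R : realType) (u : R) : 0 < u < 1 -> 0 < sin (pi * u).
Proof.
move=> u01; have p0 := pi_gt0 R; apply: sin_gt0_pi.
by apply/andP; split; nra.
Qed.

Section uniform01_trig.
Context d (T : measurableType d) (R : realType) (P : probability T R).
Variables (U : T -> R) (mU : measurable_fun setT U) (U01 : uniform01 P U).

(** Together with the next lemma this is the eigenvalue computation: integrating
    the weight cos (pi u) from 0 and then integrating the result up to 1/2 gives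
    the weight back with the factor 1 / pi ^ 2. *)
Lemma integral_cos_below (t : R) : 0 <= t <= 1/2 ->
  (\int[P]_(y in [set y | (U y < t)%R]) (cos (pi * U y))%:E
   = (sin (pi * t) / pi)%:E)%E.
Proof.
move=> t01.
have mcos := measurable_cos_pi (@measurable_id _ R setT).
rewrite (_ : [set y | _] = U @^-1` `[0, t[%classic); last first.
  apply/seteqP; split => y /=; rewrite in_itv/=; have := U01.1 y; lra.
rewrite (@ge0_integral_uniform01 _ _ _ P U `[0, t[%classic (fun u => cos (pi * u)))//.
- rewrite integral_itv_bndo_bndc ?integral_cos_pi//; first by case/andP : t01.
  exact/measurable_EFinP/measurable_funTS.
- by move=> u/=; rewrite !in_itv/=; lra.
- by move=> u/=; rewrite in_itv/= => ut; apply/ltW/cos_pi_gt0; lra.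
Qed.

Lemma integral_sin_above (t : R) : 0 <= t <= 1/2 ->
  (\int[P]_(x in [set x | (t < U x < 1/2)%R]) (sin (pi * U x))%:E
   = (cos (pi * t) / pi)%:E)%E.
Proof.
move=> t01.
have msin := measurable_sin_pi (@measurable_id _ R setT).
rewrite (_ : [set y | _] = U @^-1` `]t, (1/2)[%classic); last first.
  by apply/seteqP; split => y /=; rewrite in_itv/=.
rewrite (@ge0_integral_uniform01 _ _ _ P U `]t, (1/2)[%classic (fun u => sin (pi * u)))//.
- rewrite integral_itv_obnd_cbnd; last exact/measurable_EFinP/measurable_funTS.
  rewrite integral_itv_bndo_bndc; last exact/measurable_EFinP/measurable_funTS.
  rewrite integral_sin_pi; last by case/andP : t01.
  by rewrite (_ : pi * (1/2) = pi / 2) ?cos_pihalf ?subr0//; field.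
- by move=> u/=; rewrite !in_itv/=; lra.
- by move=> u/=; rewrite in_itv/= => ut; apply/ltW/sin_pi_gt0; lra.
Qed.

End uniform01_trig.

(** * The integral of a function below the level of a point *)

Lemma measurable_funV d (T : measurableType d) (R : realType) (f : T -> R) :
  measurable_fun setT f -> measurable_fun setT (fun x => (f x)^-1).
Proof.
move=> mf; apply: (measurableT_comp (f := fun u : R => u^-1)) => //.
rewrite -(setUv [set (0 : R)]); apply/measurable_funU => //.
  exact: measurableC.
split; first exact: measurable_fun_set1.
apply: open_continuous_measurable_fun.
  by apply: closed_openC; exact: closed_eq.
by move=> u; rewrite inE/= => /eqP u0; exact: inv_continuous.
Qed.

Definition below (T : Type) (R : realType) (U : T -> R) (x : T) : set T :=
  [set y | U y < U x].

(** When U is a distribution function of the law of X evaluated at X, this is the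
    conditional expectation of the theorem as a function of the sample point. *)
Definition integral_below d (T : measurableType d) (R : realType)
    (P : probability T R) (U psi : T -> R) (x : T) : R :=
  \int[P]_(y in below U x) psi y.

Section integral_below.
Context d (T : measurableType d) (R : realType) (P : probability T R).
Variables (U : T -> R) (mU : measurable_fun setT U).

Lemma measurable_below (x : T) : measurable (below U x).
Proof. exact: measurable_set_ltr. Qed.

Lemma measurable_set_lt_pair : measurable [set z : T * T | U z.2 < U z.1].
Proof. by apply: measurable_set_ltr; exact: measurableT_comp. Qed.

(** Tonelli gives measurability for the positive and negative parts *)
Let measurable_eintegral_below (f : T -> R) : measurable_fun setT f ->
  measurable_fun setT
    (fun x => \int[P]_(y in [set y | (U y < U x)%R]) (f y)%:E)%E.
Proof.
move=> mf.
pose h (z : T * T) : \bar R :=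
  ((fun z => (f z.2)%:E) \_ [set z : T * T | U z.2 < U z.1]) z.
have mh : measurable_fun setT h.
  apply/(measurable_restrictT _ measurable_set_lt_pair).
  apply: measurable_funTS; apply/measurable_EFinP; exact: measurableT_comp.
have mp := @measurable_fun_fubini_tonelli_F _ _ T T R P (h^\+)%E
  (measurable_funepos mh) (funepos_ge0 h).
have mn := @measurable_fun_fubini_tonelli_F _ _ T T R P (h^\-)%E
  (measurable_funeneg mh) (funeneg_ge0 h).
apply: eq_measurable_fun (emeasurable_funB mp mn) => x _.
rewrite [RHS]integral_mkcond [RHS]integralE /fubini_F.
by congr (_ - _)%E; apply: eq_integral => y _; rewrite ?funeposE ?funenegE /h !patchE.
Qed.

Lemma measurable_integral_below (f : T -> R) : measurable_fun setT f ->
  measurable_fun setT (integral_below P U f).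
Proof.
move=> mf; apply: (measurableT_comp (f := @fine R)); first exact: fine_measurable.
exact: measurable_eintegral_below.
Qed.

End integral_below.

(** * The inequality on the lower half *)

(** An event of full probability meets the event s <= U < t, whose probability is
    t - s. *)
Lemma uniform01_ae_exists d (T : measurableType d) (R : realType)
    (P : probability T R) (U : T -> R) (Q : T -> Prop) (s t : R) :
  measurable_fun setT U -> uniform01 P U -> {ae P, forall x, Q x} ->
  [&& 0 <= s, s < t & t <= 1] -> exists x, Q x /\ s <= U x < t.
Proof.
move=> mU [_ Uu] [N [mN N0 QN]] /and3P[s0 st t1].
apply: contrapT => /forallNP nQ.
have mlt u : measurable [set x | U x < u] by exact: measurable_set_ltr.
have : (P [set x | (U x < t)%R] <= P ([set x | (U x < s)%R] `|` N))%E.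
  rewrite le_measure ?inE//; first exact: measurableU.
  move=> x /= xt; have [xs|sx] := ltP (U x) s; [by left|right].
  by apply: QN => /= Qx; apply: (nQ x); rewrite sx xt.
move/le_trans => /(_ _ (measureU2 P (mlt s) mN)).
have t01 : 0 <= t <= 1 by lra.
have s01 : 0 <= s <= 1 by lra.
by rewrite [X in (_ + X)%E]N0 adde0 (Uu t t01).1 [leRHS](Uu s s01).1 lee_fin leNgt st.
Qed.

(** On U < 1/2 the weight w = cos (pi U) is positive. The sharp bound is the
    weighted Cauchy-Schwarz inequality G ^ 2 <= A * Q below each x, integrated
    over x by Tonelli. *)
Section lower_half.
Context d (T : measurableType d) (R : realType) (P : probability T R).
Variables (U psi : T -> R).
Hypotheses (mU : measurable_fun setT U) (U01 : uniform01 P U).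
Hypotheses (mpsi : measurable_fun setT psi)
  (ipsi : P.-integrable setT (EFin \o psi))
  (ipsi2 : P.-integrable setT (EFin \o (fun x => psi x ^+ 2))).

Let w x := cos (pi * U x).
Let A x := sin (pi * U x) / pi.
Let G := integral_below P U psi.
Let q x := psi x ^+ 2 / w x.
Let Q := integral_below P U q.
Let H := [set x | U x < 1/2].

Let mbelow x : measurable (below U x). Proof. exact: measurable_below. Qed.

Let mH : measurable H. Proof. exact: measurable_set_ltr. Qed.

Let mw : measurable_fun setT w. Proof. exact: measurable_cos_pi. Qed.

Let mq : measurable_fun setT q.
Proof. by apply: measurable_funM; [exact: measurable_funX|exact: measurable_funV]. Qed.

Let mA : measurable_fun setT A.
Proof. by apply: measurable_funM => //; exact: measurable_sin_pi. Qed.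

Let mG : measurable_fun setT G. Proof. exact: measurable_integral_below. Qed.

Let mQ : measurable_fun setT Q. Proof. exact: measurable_integral_below. Qed.

Let w_gt0 x : H x -> 0 < w x.
Proof. by move=> Hx; apply: cos_pi_gt0; have := U01.1 x; rewrite /H/= in Hx; lra. Qed.

Let q_ge0 x : H x -> 0 <= q x.
Proof. by move=> /w_gt0/ltW w0; rewrite /q divr_ge0// sqr_ge0. Qed.

Let below_H x : H x -> below U x `<=` H.
Proof. by rewrite /H /below => Hx y/= /lt_trans; exact. Qed.

(** w decreases on the lower half, so q is dominated below x by psi ^ 2 / w x *)
Let w_below x y : H x -> below U x y -> w x < w y.
Proof.
rewrite /H /below/= /w => Hx yx; have p0 := pi_gt0 R.
have [x01 y01] := (U01.1 x, U01.1 y).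
rewrite ltr_cos ?ltr_pM2l// in_itv/=; apply/andP; split; nra.
Qed.

Let ibelow x (f : T -> R) : P.-integrable setT (EFin \o f) ->
  P.-integrable (below U x) (EFin \o f).
Proof. by move=> fi; apply: (integrableS measurableT) fi. Qed.

Let iw x : P.-integrable (below U x) (EFin \o w).
Proof.
apply: ibelow; apply: (le_integrable measurableT _ _ (g := cst 1%E)).
- exact/measurable_EFinP.
- by move=> y _; rewrite /= normr1 lee_fin cos_max.
- exact: finite_measure_integrable_cst.
Qed.

Let iq x : H x -> P.-integrable (below U x) (EFin \o q).
Proof.
move=> Hx; have w0 := w_gt0 Hx.
apply: (le_integrable (mbelow x) _ _ (g := fun y => ((w x)^-1%:E * (psi y ^+ 2)%:E)%E)).
- exact/measurable_EFinP/measurable_funTS.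
- move=> y yx; have wy0 := w_gt0 (below_H Hx yx).
  rewrite -EFinM /= lee_fin /q !normrM mulrC ler_wpM2r// !ger0_norm ?invr_ge0 ?ltW//.
  by rewrite ltf_pV2// w_below.
- by apply: integrableZl => //; exact: ibelow.
Qed.

Let Rintegral_w x : H x -> integral_below P U w x = A x.
Proof.
move=> Hx; rewrite /integral_below /Rintegral integral_cos_below//.
by have := U01.1 x; rewrite /H/= in Hx; lra.
Qed.

(** Expansion of the weighted distance of psi from c * w; the choice
   c = G x / A x minimizes it and turns it into D x / A x *)
Let defectE x c : H x ->
  (\int[P]_(y in below U x) ((psi y - c * w y) ^+ 2 / w y)%:E)%E
  = (Q x - 2 * c * G x + c ^+ 2 * A x)%:E.
Proof.
move=> Hx.
transitivity (\int[P]_(y in below U x) (q y - 2 * c * psi y + c ^+ 2 * w y)%:E)%E.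
  apply: eq_integral => y; rewrite inE => yx; congr EFin; rewrite /q.
  by have := lt0r_neq0 (w_gt0 (below_H Hx yx)); move: (w y) => v v0; field.
have i1 := iq Hx.
have i2 : P.-integrable (below U x) (EFin \o (fun y => 2 * c * psi y)).
  exact: (integrableZl (mbelow x) (2 * c) (ibelow x ipsi)).
have i3 : P.-integrable (below U x) (EFin \o (fun y => c ^+ 2 * w y)).
  exact: (integrableZl (mbelow x) (c ^+ 2) (iw x)).
have i12 : P.-integrable (below U x) (EFin \o (fun y => q y - 2 * c * psi y)).
  exact: (integrableB (mbelow x) i1 i2).
have i123 : P.-integrable (below U x)
    (EFin \o (fun y => q y - 2 * c * psi y + c ^+ 2 * w y)).
  exact: (integrableD (mbelow x) i12 i3).
rewrite -[LHS]fineK; last exact: integrable_fin_num i123.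
congr EFin.
rewrite -/(Rintegral P (below U x) (fun y => q y - 2 * c * psi y + c ^+ 2 * w y)).
rewrite RintegralD// RintegralB// RintegralZl//; last exact: ibelow.
by rewrite RintegralZl// -(Rintegral_w Hx).
Qed.

Let A_ge0 x : H x -> 0 <= A x.
Proof.
move=> Hx; rewrite -Rintegral_w//; apply: Rintegral_ge0 => y /(below_H Hx).
by move=> /w_gt0/ltW.
Qed.

Let below0 x : U x = 0 -> below U x = set0.
Proof.
move=> x0; rewrite -subset0 => y; rewrite /below/= x0.
by have := U01.1 y; lra.
Qed.

Let A_gt0 x : H x -> 0 < U x -> 0 < A x.
Proof.
move=> Hx x0; rewrite divr_gt0 ?pi_gt0// sin_pi_gt0//.
by rewrite /H/= in Hx; lra.
Qed.

Let U0P x : U x = 0 \/ 0 < U x.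
Proof. by have /andP[] := U01.1 x; rewrite le_eqVlt => /predU1P[<-|]; [left|right]. Qed.

(** The defect of the Cauchy-Schwarz inequality *)
Let D x := A x * Q x - G x ^+ 2.

Let mD : measurable_fun setT D.
Proof. by apply: measurable_funB; [exact: measurable_funM|exact: measurable_funX]. Qed.

Let cauchy_schwarz x : H x -> 0 <= D x.
Proof.
move=> Hx; rewrite /D; have [/below0 x0|x0] := U0P x.
  by rewrite /A /G /Q /integral_below x0 !Rintegral_set0 mulr0 expr0n subr0.
have A0 := A_gt0 Hx x0.
have : (0 <= (Q x - 2 * (G x / A x) * G x + (G x / A x) ^+ 2 * A x)%:E)%E.
  rewrite -defectE//; apply: integral_ge0 => y /(below_H Hx)/w_gt0/ltW wy.
  by rewrite lee_fin divr_ge0// sqr_ge0.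
rewrite lee_fin [X in 0 <= X -> _](_ : _ = (A x * Q x - G x ^+ 2) / A x).
  by rewrite pmulr_lge0// invr_gt0.
by have := lt0r_neq0 A0; move: (A x) => a a0; field.
Qed.

(** The equality case: psi is proportional to w below x *)
Let defect0 x : H x -> 0 < U x -> D x = 0 ->
  {ae P, forall y, U y < U x -> psi y = G x / A x * w y}.
Proof.
move=> Hx x0 D0; have A0 := A_gt0 Hx x0; set c := G x / A x.
have : (\int[P]_(y in below U x) `|((psi y - c * w y) ^+ 2 / w y)%:E| = 0)%E.
  transitivity (\int[P]_(y in below U x) ((psi y - c * w y) ^+ 2 / w y)%:E)%E.
    apply: eq_integral => y; rewrite inE => /(below_H Hx)/w_gt0/ltW wy.
    by rewrite gee0_abs// lee_fin divr_ge0// sqr_ge0.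
  rewrite defectE//; transitivity (D x / A x)%:E; last by rewrite D0 mul0r.
  congr EFin; rewrite /D /c; have := lt0r_neq0 A0.
  by move: (A x) => a a0; field.
move/(ae_eq_integral_abs _ (mbelow x)) => /(_ _)[].
  apply/measurable_EFinP; apply: measurable_funTS; apply: measurable_funM.
    by apply: measurable_funX; apply: measurable_funB => //; exact: measurable_funM.
  exact: measurable_funV.
move=> N [mN N0 sN]; exists N; split=> // y /= /not_implyP[yx ne]; apply: sN => /=.
apply/not_implyP; split => // -[/eqP].
have wy := lt0r_neq0 (w_gt0 (below_H Hx yx)).
by rewrite mulf_eq0 invr_eq0 (negbTE wy) orbF sqrf_eq0 subr_eq0 => /eqP.
Qed.

(** Exchanging the integrals over the triangle U y < U x < 1/2 leaves the integral
   of A over U y < U x < 1/2, which is w y / pi ^ 2 and cancels the weight in q *)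
Let tonelli :
  (\int[P]_(x in H) (A x * Q x)%:E =
   ((pi ^+ 2)^-1)%:E * \int[P]_(x in H) (psi x ^+ 2)%:E)%E.
Proof.
pose S := [set z : T * T | U z.2 < U z.1 /\ U z.1 < 1/2].
pose f (z : T * T) := (EFin \o (fun z => A z.1 * q z.2)) \_ S z.
have mS : measurable S.
  apply: measurableI; first exact: measurable_set_lt_pair.
  by apply: measurable_set_ltr => //; exact: measurableT_comp.
have mf : measurable_fun setT f.
  apply/(measurable_restrictT _ mS).
  apply/measurable_EFinP/measurable_funTS.
  by apply: measurable_funM; exact: measurableT_comp.
have f0 z : (0 <= f z)%E.
  rewrite /f patchE; case: ifPn => // /[1!inE] -[/= z1 z2].
  by rewrite lee_fin mulr_ge0 ?A_ge0// q_ge0// /H/= (lt_trans z1).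
have := fubini_tonelli (m1 := P) (m2 := P) f mf f0.
rewrite (_ : (\int[P]_x _)%E = \int[P]_(x in H) (A x * Q x)%:E)%E; last first.
  rewrite [RHS]integral_mkcond; apply: eq_integral => x _.
  rewrite patchE; have [Hx|Hx] := pselect (H x); last first.
    rewrite memNset// integral0_eq// => y _; rewrite /f patchE memNset//= => -[_ /=].
    exact: Hx.
  rewrite mem_set//.
  transitivity (\int[P]_(y in below U x) ((A x)%:E * (q y)%:E))%E.
    rewrite [RHS]integral_mkcond; apply: eq_integral => y _.
    rewrite /f !patchE; congr (if _ then _ else _).
    by apply/idP/idP; rewrite !inE /S /below/=; [case|split].
  rewrite integralZl//; last exact: iq.
  rewrite [RHS]EFinM /Q /integral_below /Rintegral fineK//.
  apply: integrable_fin_num => //.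
  exact: iq.
move=> ->; rewrite -ge0_integralZl//; last 3 first.
- apply/measurable_EFinP; apply: measurable_funTS; exact: measurable_funX.
- by move=> x _; rewrite lee_fin sqr_ge0.
- by rewrite lee_fin invr_ge0 sqr_ge0.
rewrite [RHS]integral_mkcond; apply: eq_integral => y _.
rewrite patchE; have [Hy|Hy] := pselect (H y); last first.
  rewrite memNset// integral0_eq// => x _; rewrite /f patchE memNset//= => -[/= yx xh].
  by apply: Hy; rewrite /H/= (lt_trans yx).
rewrite mem_set//; have wy := w_gt0 Hy; have p0 := pi_gt0 R.
have Uy : 0 <= U y <= 1/2 by have := U01.1 y; rewrite /H/= in Hy; lra.
transitivity (\int[P]_(x in [set x | (U y < U x < 1/2)%R])
   ((q y / pi)%:E * (sin (pi * U x))%:E))%E.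
  rewrite [RHS]integral_mkcond; apply: eq_integral => x _.
  rewrite /f !patchE; congr (if _ then _ else _).
    by apply/idP/idP; rewrite !inE /S/=; [case=> -> ->|move/andP].
  by rewrite /A /= -EFinM; congr EFin; ring.
have mUU : measurable [set x | U y < U x < 1/2].
  rewrite (_ : [set _ | _] = [set x | U y < U x] `&` H); last first.
    by apply/seteqP; split=> x /=; rewrite /H/= => /andP.
  by apply: measurableI => //; exact: measurable_set_ltr.
rewrite ge0_integralZl//.
- rewrite integral_sin_above// -!EFinM; congr EFin.
  rewrite /q -/(w y); move: (lt0r_neq0 wy) (lt0r_neq0 p0).
  by move: (w y) (@pi R) => v p v0 q0; field; rewrite v0 q0.
- by apply/measurable_EFinP; apply: measurable_funTS; exact: measurable_sin_pi.
- move=> x /= xy; rewrite lee_fin; apply/ltW/sin_pi_gt0.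
  by have := U01.1 y; lra.
- by rewrite lee_fin divr_ge0 ?(ltW p0)// q_ge0.
Qed.

Let G2_plus_defect :
  (\int[P]_(x in H) (G x ^+ 2)%:E + \int[P]_(x in H) (D x)%:E =
   ((pi ^+ 2)^-1)%:E * \int[P]_(x in H) (psi x ^+ 2)%:E)%E.
Proof.
rewrite -tonelli -ge0_integralD//.
- by apply: eq_integral => x _; rewrite -EFinD /D; congr EFin; ring.
- by move=> x _; rewrite lee_fin sqr_ge0.
- by apply/measurable_EFinP; apply: measurable_funTS; exact: measurable_funX.
- by apply/measurable_EFinP; exact: measurable_funTS.
Qed.

Lemma lower_half_le :
  (\int[P]_(x in [set x | (U x < 1/2)%R]) (integral_below P U psi x ^+ 2)%:E <=
   ((pi ^+ 2)^-1)%:E *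
   \int[P]_(x in [set x | (U x < 1/2)%R]) (psi x ^+ 2)%:E)%E.
Proof.
rewrite -G2_plus_defect leeDl//; apply: integral_ge0 => x Hx.
by rewrite lee_fin cauchy_schwarz.
Qed.

Let G2_fin : (\int[P]_(x in H) (G x ^+ 2)%:E)%E \is a fin_num.
Proof.
rewrite ge0_fin_numE; last by apply: integral_ge0 => x _; rewrite lee_fin sqr_ge0.
apply: le_lt_trans lower_half_le _; rewrite lte_mul_pinfty//.
  by rewrite lee_fin invr_ge0 sqr_ge0.
have i2 : P.-integrable H (EFin \o (fun x => psi x ^+ 2)).
  exact: (integrableS measurableT mH (@subsetT _ _)) ipsi2.
by have := integrable_fin_num mH i2; rewrite fin_numElt => /andP[].
Qed.

Let eq_split :
  (\int[P]_(x in H) (G x ^+ 2)%:E =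
   ((pi ^+ 2)^-1)%:E * \int[P]_(x in H) (psi x ^+ 2)%:E)%E <->
  (\int[P]_(x in H) (D x)%:E = 0)%E.
Proof.
rewrite -G2_plus_defect; split=> [|->]; last by rewrite adde0.
move: G2_fin; case: (\int[P]_(x in H) (G x ^+ 2)%:E)%E => // g _.
case: (\int[P]_(x in H) (D x)%:E)%E => //= r; rewrite -EFinD => -[gr].
by congr EFin; lra.
Qed.

(** The factor of proportionality below x does not depend on x, because the sets
   below two points always overlap; points x n with U (x n) close to 1/2 then
   cover the whole lower half *)
Let forward : (\int[P]_(x in H) (D x)%:E = 0)%E ->
  exists a, {ae P, forall x, U x < 1/2 -> psi x = a * cos (pi * U x)}.
Proof.
move=> D0.
have aeD : {ae P, forall x, H x -> D x = 0}.
  have : (\int[P]_(x in H) `|(D x)%:E| = 0)%E.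
    rewrite -D0; apply: eq_integral => x; rewrite inE => Hx.
    by rewrite gee0_abs// lee_fin cauchy_schwarz.
  move/(ae_eq_integral_abs _ mH) => /(_ _)[].
    by apply/measurable_EFinP; exact: measurable_funTS.
  move=> N [mN N0 sN]; exists N; split=> // x /= /not_implyP[Hx ne]; apply: sN => /=.
  by apply/not_implyP; split => // -[].
(* n.+3 keeps s n positive, so that A (x n) is nonzero *)
pose s (n : nat) : R := 1/2 - (n.+3%:R)^-1.
have s_gt0 n : 0 < s n.
  rewrite subr_gt0 mul1r ltf_pV2 ?posrE//.
  by rewrite ltr_nat.
have /choice[x xP] : forall n, exists x, (H x -> D x = 0) /\ s n <= U x < 1/2.
  move=> n; apply: (uniform01_ae_exists mU U01 aeD); apply/and3P; split.
  - exact/ltW/s_gt0.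
  - by rewrite /s ltrBlDr ltrDl invr_gt0.
  - lra.
have Hx n : H (x n) by have [_ /andP[]] := xP n.
have x0 n : 0 < U (x n) by have [_ /andP[+ _]] := xP n; exact: lt_le_trans.
pose c n := G (x n) / A (x n).
have /ae_foralln psiE n : {ae P, forall y, U y < U (x n) -> psi y = c n * w y}.
  by apply: defect0 => //; exact: (xP n).1.
have cE n : c n = c 0%N.
  have [|y [yE /andP[_]]] := @uniform01_ae_exists _ _ _ _ _ _ 0
      (Num.min (U (x n)) (U (x 0%N))) mU U01 psiE.
    rewrite lexx lt_min !x0/= ge_min.
    by have := U01.1 (x n) => /andP[_ ->].
  rewrite lt_min => /andP[yn y0].
  have wy : w y != 0 by apply/lt0r_neq0/w_gt0; exact: below_H y0.
  by apply: (mulIf wy); rewrite -(yE _ yn) -(yE _ y0).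
exists (c 0%N); apply: filterS psiE => y yE Hy.
have [n ny] : exists n, U y < s n.
  have e0 : 0 < 1/2 - U y by lra.
  exists (Num.truncn (1/2 - U y)^-1); rewrite /s ltrBrDl -ltrBrDr.
  rewrite invf_plt ?posrE//.
  rewrite (lt_trans (Num.Theory.truncnS_gt _))// ltr_nat.
  by rewrite ltnS.
have [_ /andP[sx _]] := xP n.
by rewrite (yE n) ?cE// (lt_le_trans ny).
Qed.

Let backward a :
  {ae P, forall x, U x < 1/2 -> psi x = a * cos (pi * U x)} ->
  (\int[P]_(x in H) (D x)%:E = 0)%E.
Proof.
move=> psiE; rewrite integral0_eq// => x Hx; congr EFin.
have GE : G x = a * A x.
  rewrite -Rintegral_w// -RintegralZl//.
  congr fine; apply: ae_eq_integral => //.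
  - by apply/measurable_EFinP; exact: measurable_funTS.
  - apply/measurable_EFinP; apply: measurable_funTS.
    exact: (measurable_funM (measurable_cst a)).
  - by apply: filterS psiE => y yE /(below_H Hx) yH /=; rewrite yE.
have QE : Q x = a ^+ 2 * A x.
  rewrite -Rintegral_w// -RintegralZl//.
  congr fine; apply: ae_eq_integral => //.
  - by apply/measurable_EFinP; exact: measurable_funTS.
  - apply/measurable_EFinP; apply: measurable_funTS.
    exact: (measurable_funM (measurable_cst (a ^+ 2))).
  - apply: filterS psiE => y yE /(below_H Hx) yH /=; rewrite /q yE// -/(w y).
    by congr EFin; have := lt0r_neq0 (w_gt0 yH); move: (w y) => v v0; field.
by rewrite /D GE QE; ring.
Qed.

Lemma lower_half_eq :
  (\int[P]_(x in [set x | (U x < 1/2)%R]) (integral_below P U psi x ^+ 2)%:E =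
   ((pi ^+ 2)^-1)%:E *
   \int[P]_(x in [set x | (U x < 1/2)%R]) (psi x ^+ 2)%:E)%E <->
  exists a, {ae P, forall x, U x < 1/2 -> psi x = a * cos (pi * U x)}.
Proof.
split=> [/eq_split/forward//|[a /backward h]]; exact/eq_split.
Qed.

End lower_half.

(** * The inequality for a uniform variable *)

Lemma uniform01_eq0 d (T : measurableType d) (R : realType)
    (P : probability T R) (U : T -> R) (u : R) :
  measurable_fun setT U -> uniform01 P U -> P [set x | U x = u] = 0%E.
Proof.
move=> mU [U01 Uu].
have mlt : measurable [set x | U x < u] by exact: measurable_set_ltr.
have mle : measurable [set x | U x <= u] by exact: measurable_set_ler.
have eqE : [set x | U x = u] = [set x | U x <= u] `\` [set x | U x < u].
  apply/seteqP; split => x /=; first by move=> ->; rewrite lexx ltxx.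
  by move=> [xu /negP]; rewrite -leNgt => ux; apply/eqP; rewrite eq_le xu.
have meq : measurable [set x | U x = u] by rewrite eqE; exact: measurableD.
have [u01|u01] := boolP (0 <= u <= 1); last first.
  rewrite (_ : [set _ | _] = set0) ?measure0// -subset0 => x /= xu.
  by move: u01; rewrite -xu U01.
have [Pl Pr] := Uu _ u01.
have : P [set x | U x <= u] = (P [set x | (U x < u)%R] + P [set x | U x = u])%E.
  rewrite -measureU//; last first.
    by rewrite -subset0 => x [/=] xu xE; rewrite xE ltxx in xu.
  congr (P _); apply/seteqP; split => x /=.
    by rewrite le_eqVlt => /predU1P[|]; [right|left].
  by move=> [/ltW//|->].
rewrite Pr Pl => /esym/eqP; rewrite -[X in _ == X]adde0.
have : P [set x | U x = u] \is a fin_num by exact: fin_num_measure.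
case: (P [set x | U x = u]) => // r _; rewrite -!EFinD => /eqP[].
by move/addrI ->.
Qed.

(** The upper half U > 1/2 is the lower half of 1 - U; the level U = 1/2 is null. *)
Section reflection.
Context d (T : measurableType d) (R : realType) (P : probability T R).
Variables (U psi : T -> R).
Hypotheses (mU : measurable_fun setT U) (U01 : uniform01 P U).

Let mUC : measurable_fun setT (fun x => 1 - U x).
Proof. exact: measurable_funB. Qed.

Let mlo : measurable [set x | U x < 1/2].
Proof. exact: measurable_set_ltr. Qed.

Let mhi : measurable [set x | 1 - U x < 1/2].
Proof. exact: measurable_set_ltr. Qed.

Let meq u : measurable [set x | U x = u].
Proof.
rewrite (_ : [set _ | _] = U @^-1` [set u])//.
by rewrite -[X in measurable X]setTI; exact: mU.
Qed.

Let halves : [set: T] `\` [set x | U x = 1/2] =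
  [set x | U x < 1/2] `|` [set x | 1 - U x < 1/2].
Proof.
apply/seteqP; split => x /=.
  by move=> [_ /eqP]; rewrite neq_lt => /orP[|?]; [left|right; lra].
by move=> h; split => // xE; move: h => []; lra.
Qed.

Let disj : [disjoint [set x | U x < 1/2] & [set x | 1 - U x < 1/2]].
Proof. by apply/disj_set2P; rewrite -subset0 => x /= []; lra. Qed.

Lemma ge0_integral_halves (f : T -> \bar R) :
  measurable_fun setT f -> (forall x, 0 <= f x)%E ->
  (\int[P]_x f x = \int[P]_(x in [set x | (U x < 1/2)%R]) f x
    + \int[P]_(x in [set x | (1 - U x < 1/2)%R]) f x)%E.
Proof.
move=> mf f0.
rewrite (ge0_negligible_integral (meq (1/2)))//; last exact: uniform01_eq0.
by rewrite halves ge0_integral_setU//; exact: measurable_funTS.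
Qed.

Lemma Rintegral_halves : P.-integrable setT (EFin \o psi) ->
  \int[P]_x psi x = \int[P]_(x in [set x | U x < 1/2]) psi x
    + \int[P]_(x in [set x | 1 - U x < 1/2]) psi x.
Proof.
move=> ipsi; rewrite -Rintegral_setU//; last first.
  exact: (integrableS measurableT (measurableU _ _ mlo mhi) (@subsetT _ _) ipsi).
rewrite /Rintegral (negligible_integral (meq (1/2)))//; last exact: uniform01_eq0.
by rewrite halves.
Qed.

(** The integrals of psi below and above x add up to the total integral 0, so the
    reflection only changes the sign of the function to be squared. *)
Lemma integral_belowC x : P.-integrable setT (EFin \o psi) ->
  \int[P]_x psi x = 0 ->
  integral_below P (fun x => 1 - U x) psi x = - integral_below P U psi x.
Proof.
move=> ipsi psi0; rewrite /integral_below.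
have mle : measurable [set y | U y <= U x] by exact: measurable_set_ler.
have mgt : measurable (below (fun x => 1 - U x) x) by exact: measurable_set_ltr.
have setTE : [set: T] = [set y | U y <= U x] `|` below (fun x => 1 - U x) x.
  apply/esym; rewrite -subTset => y _ /=; rewrite /below/=.
  by have [|] := leP (U y) (U x); [left|right; lra].
move: psi0; rewrite {1}setTE Rintegral_setU//; last 2 first.
- by rewrite -setTE.
- by apply/disj_set2P; rewrite -subset0 => y /=; rewrite /below/= => -[]; lra.
rewrite {1}/Rintegral (negligible_integral (meq (U x)))//; last 2 first.
- exact: (integrableS measurableT mle (@subsetT _ _) ipsi).
- exact: uniform01_eq0.
rewrite (_ : _ `\` _ = below U x); last first.
  apply/seteqP; split => y /=; rewrite /below/=.
    by move=> [yx /eqP ne]; rewrite lt_neqAle ne.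
  by move=> yx; split; [exact: ltW|move=> yE; rewrite yE ltxx in yx].
by move/eqP; rewrite addr_eq0 => /eqP h; rewrite -[LHS]opprK -h.
Qed.

(** Recovers the amplitude on a half from the integral; the two halves have
    opposite integrals, which matches their amplitudes. *)
Lemma Rintegral_cos_half (a : R) : measurable_fun setT psi ->
  {ae P, forall x, U x < 1/2 -> psi x = a * cos (pi * U x)} ->
  \int[P]_(x in [set x | U x < 1/2]) psi x = a / pi.
Proof.
move=> mpsi psiE.
have mcos : measurable_fun setT (fun x => cos (pi * U x)) by exact: measurable_cos_pi.
transitivity (\int[P]_(x in [set x | U x < 1/2]) (a * cos (pi * U x))).
  congr fine; apply: ae_eq_integral => //.
  - by apply/measurable_EFinP; exact: measurable_funTS.
  - apply/measurable_EFinP; apply: measurable_funTS.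
    exact: (measurable_funM (measurable_cst a)).
  - by apply: filterS psiE => x h /= xh; rewrite h.
rewrite RintegralZl//.
  rewrite /Rintegral integral_cos_below//; last by lra.
  rewrite (_ : pi * (1/2) = pi / 2) ?sin_pihalf ?mul1r//.
apply: (le_integrable mlo _ _ (g := cst 1%E)).
- exact/measurable_EFinP/measurable_funTS.
- by move=> y _; rewrite /= normr1 lee_fin cos_max.
- exact: finite_measure_integrable_cst.
Qed.

End reflection.

Lemma eq_of_le_sum (R : realType) (a1 a2 b1 b2 : \bar R) :
  (b1 \is a fin_num -> b2 \is a fin_num -> 0 <= a1 -> 0 <= a2 ->
  a1 <= b1 -> a2 <= b2 ->
  a1 + a2 = b1 + b2 -> a1 = b1 /\ a2 = b2)%E.
Proof.
move: a1 a2 b1 b2 => [a1||] [a2||] [b1||] [b2||]//= _ _ _ _.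
by rewrite !lee_fin -!EFinD => h1 h2 [h]; split; congr EFin; lra.
Qed.

Lemma cos_piC (R : realType) (u : R) : cos (pi * (1 - u)) = - cos (pi * u).
Proof. by rewrite mulrBr mulr1 cosB cospi sinpi; ring. Qed.

Section uniform_inequality.
Context d (T : measurableType d) (R : realType) (P : probability T R).
Variables (U psi : T -> R).
Hypotheses (mU : measurable_fun setT U) (U01 : uniform01 P U).
Hypotheses (mpsi : measurable_fun setT psi)
  (ipsi : P.-integrable setT (EFin \o psi))
  (ipsi2 : P.-integrable setT (EFin \o (fun x => psi x ^+ 2)))
  (psi0 : \int[P]_x psi x = 0).

Let V x := 1 - U x.

Let mV : measurable_fun setT V. Proof. exact: measurable_funB. Qed.

Let V01 : uniform01 P V. Proof. exact: uniform01C. Qed.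

Let lo := [set x | U x < 1/2].
Let hi := [set x | V x < 1/2].
Let G := integral_below P U psi.
Let k : \bar R := ((pi ^+ 2)^-1)%:E.

Let G2_halves : (\int[P]_x (G x ^+ 2)%:E =
  \int[P]_(x in lo) (G x ^+ 2)%:E + \int[P]_(x in hi) (G x ^+ 2)%:E)%E.
Proof.
apply: ge0_integral_halves => //.
  by apply/measurable_EFinP/measurable_funX; exact: measurable_integral_below.
by move=> x; rewrite lee_fin sqr_ge0.
Qed.

Let psi2_halves : (k * \int[P]_x (psi x ^+ 2)%:E =
  k * \int[P]_(x in lo) (psi x ^+ 2)%:E + k * \int[P]_(x in hi) (psi x ^+ 2)%:E)%E.
Proof.
rewrite (@ge0_integral_halves _ _ _ P U)//.
- rewrite ge0_muleDr//; apply: integral_ge0 => x _; by rewrite lee_fin sqr_ge0.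
- by apply/measurable_EFinP/measurable_funX.
- by move=> x; rewrite lee_fin sqr_ge0.
Qed.

Let GV_hi : (\int[P]_(x in hi) (integral_below P V psi x ^+ 2)%:E
  = \int[P]_(x in hi) (G x ^+ 2)%:E)%E.
Proof.
by apply: eq_integral => x _; rewrite integral_belowC// sqrrN.
Qed.

Let le_lo : (\int[P]_(x in lo) (G x ^+ 2)%:E <= k * \int[P]_(x in lo) (psi x ^+ 2)%:E)%E.
Proof. exact: lower_half_le. Qed.

Let le_hi : (\int[P]_(x in hi) (G x ^+ 2)%:E <= k * \int[P]_(x in hi) (psi x ^+ 2)%:E)%E.
Proof. by rewrite -GV_hi; exact: lower_half_le. Qed.

Lemma uniform_le : (\int[P]_x (integral_below P U psi x ^+ 2)%:E <=
  ((pi ^+ 2)^-1)%:E * \int[P]_x (psi x ^+ 2)%:E)%E.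
Proof. by rewrite G2_halves psi2_halves leeD. Qed.

Let psi2_fin (D : set T) : measurable D ->
  (k * \int[P]_(x in D) (psi x ^+ 2)%:E)%E \is a fin_num.
Proof.
move=> mD; rewrite fin_numM//; apply: integrable_fin_num => //.
exact: (integrableS measurableT mD (@subsetT _ _) ipsi2).
Qed.

(** Equality of the sums forces equality on each half. The amplitudes a on the
    lower half and b on the upper half satisfy a / pi + b / pi = 0, and
    cos (pi (1 - u)) = - cos (pi u), so both halves are given by a cos (pi U). *)
Lemma uniform_eq :
  (\int[P]_x (integral_below P U psi x ^+ 2)%:E =
  ((pi ^+ 2)^-1)%:E * \int[P]_x (psi x ^+ 2)%:E)%E <->
  exists a, {ae P, forall x, psi x = a * cos (pi * U x)}.
Proof.
rewrite G2_halves psi2_halves; split=> [h|[a psiE]].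
  have ge0 D : (0 <= \int[P]_(x in D) (G x ^+ 2)%:E)%E.
    by apply: integral_ge0 => x _; rewrite lee_fin sqr_ge0.
  have mlo : measurable lo by exact: measurable_set_ltr.
  have mhi : measurable hi by exact: measurable_set_ltr.
  have [eq_lo eq_hi] := eq_of_le_sum (psi2_fin mlo) (psi2_fin mhi)
    (ge0 lo) (ge0 hi) le_lo le_hi h.
  have /(lower_half_eq mU U01 mpsi ipsi ipsi2)[a loE] := eq_lo.
  move: eq_hi; rewrite -GV_hi => /(lower_half_eq mV V01 mpsi ipsi ipsi2)[b hiE].
  have ab : b = - a.
    move: psi0; rewrite (Rintegral_halves mU U01)//.
    rewrite (Rintegral_cos_half mU U01 mpsi loE) (Rintegral_cos_half mV V01 mpsi hiE).
    rewrite -mulrDl => /eqP; rewrite mulf_eq0 invr_eq0 (gt_eqF (pi_gt0 R)) orbF.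
    by rewrite addrC addr_eq0 => /eqP.
  exists a.
  have mid : {ae P, forall x, U x <> 1/2}.
    exists [set x | U x = 1/2]; split.
    - rewrite (_ : [set _ | _] = U @^-1` [set (1/2 : R)])//.
      by rewrite -[X in measurable X]setTI; exact: mU.
    - exact: uniform01_eq0.
    - by move=> x /= /contrapT.
  apply: filterS3 loE hiE mid => x xlo xhi /eqP; rewrite neq_lt => /orP[/xlo//|xh].
  by rewrite xhi /V ?ab ?cos_piC ?mulrNN//; lra.
congr (_ + _)%E.
  by apply/(lower_half_eq mU U01 mpsi ipsi ipsi2); exists a; apply: filterS psiE => x ->.
rewrite -GV_hi; apply/(lower_half_eq mV V01 mpsi ipsi ipsi2); exists (- a).
by apply: filterS psiE => x -> _; rewrite cos_piC mulrNN.
Qed.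

End uniform_inequality.

(** * Conditional expectations and the theorem *)

(** The function is bounded by the integral of |psi|. This rules out equality
    when psi is not square integrable. *)
Lemma integral_below_sqr_lty d (T : measurableType d) (R : realType)
    (P : probability T R) (U psi : T -> R) : measurable_fun setT U ->
  P.-integrable setT (EFin \o psi) ->
  (\int[P]_x (integral_below P U psi x ^+ 2)%:E < +oo)%E.
Proof.
move=> mU ipsi; have mpsi : measurable_fun setT psi.
  by apply/measurable_EFinP; exact: measurable_int ipsi.
have /integrableP[_ psioo] := ipsi.
set M : \bar R := (\int[P]_y `|(psi y)%:E|)%E in psioo.
have M0 : (0 <= M)%E by exact: integral_ge0.
have MfE : M = (fine M)%:E by rewrite fineK// ge0_fin_numE.
have GM x : `|integral_below P U psi x| <= fine M.
  have mb : measurable (below U x) by exact: measurable_below.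
  have ib : P.-integrable (below U x) (EFin \o psi).
    exact: (integrableS measurableT mb (@subsetT _ _) ipsi).
  rewrite -lee_fin -MfE EFin_normr_Rintegral//.
  apply: (le_trans (le_abse_integral _ mb (measurable_int _ ib))).
  apply: ge0_subset_integral => //.
  exact/measurableT_comp/measurable_EFinP.
apply: (@le_lt_trans _ _ (\int[P]_x (fine M ^+ 2)%:E)%E).
  apply: ge0_le_integral => //.
  - by move=> x _; rewrite lee_fin sqr_ge0.
  - by apply/measurable_EFinP/measurable_funX; exact: measurable_integral_below.
  - move=> x _; rewrite lee_fin -real_normK ?num_real//.
    by rewrite lerXn2r ?nnegrE// fine_ge0.
by rewrite integral_cst// [X in (_ * X)%E]probability_setT mule1 ltry.
Qed.

(** Versions of a conditional expectation agree almost everywhere. *)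
Lemma is_cond_expectation_unique d (T : measurableType d) (R : realType)
    (P : probability T R) (X : {RV P >-> R}) (Z W1 W2 : T -> R) :
  is_cond_expectation P (sigma_of X) Z W1 ->
  is_cond_expectation P (sigma_of X) Z W2 -> {ae P, forall w, W1 w = W2 w}.
Proof.
pose S := g_sigma_algebra_preimageType (X : T -> R).
have mS W : (forall B : set R, measurable B -> sigma_of X (W @^-1` B)) ->
    measurable_fun [set: S] (W : S -> R).
  by move=> h _ B mB; rewrite setTI; exact: h.
have SmT A : sigma_of X A -> measurable A.
  by move=> [B mB <-]; apply: measurable_funP.
(* the set where one version exceeds another is itself X-measurable, so the
   two versions have the same integral over it *)
have half V1 V2 : is_cond_expectation P (sigma_of X) Z V1 ->
    is_cond_expectation P (sigma_of X) Z V2 -> {ae P, forall w, V1 w <= V2 w}.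
  move=> [m1 i1 e1] [m2 i2 e2].
  have SA : sigma_of X [set w | V2 w < V1 w].
    have := measurable_fun_ltr (mS _ m2) (mS _ m1).
    by move=> /(_ measurableT [set true] I); rewrite setTI.
  set A := [set w | V2 w < V1 w] in SA; have mA := SmT _ SA.
  have j1 := integrableS measurableT mA (@subsetT _ _) i1.
  have j2 := integrableS measurableT mA (@subsetT _ _) i2.
  have : (\int[P]_(w in A) `|(V1 w - V2 w)%:E| = 0)%E.
    transitivity (\int[P]_(w in A) (V1 w - V2 w)%:E)%E.
      apply: eq_integral => w; rewrite inE /A/= => wA.
      by rewrite ger0_norm// subr_ge0 ltW.
    under eq_integral do rewrite EFinB.
    rewrite integralB// e1// -e2// subee//.
    exact: integrable_fin_num j2.
  move/(ae_eq_integral_abs _ mA) => /(_ _)[].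
    have /measurable_EFinP mV1 := measurable_int _ j1.
    have /measurable_EFinP mV2 := measurable_int _ j2.
    by apply/measurable_EFinP; exact: measurable_funB.
  move=> N [mN N0 sN]; exists N; split=> // w /= /negP; rewrite -ltNge => wA.
  apply: sN => /=; apply/not_implyP; split => // -[] /eqP.
  by rewrite subr_eq0 gt_eqF.
move=> h1 h2; have := half _ _ h2 h1; have := half _ _ h1 h2.
by apply: filterS2 => w le12 le21; apply/eqP; rewrite eq_le le12.
Qed.

Lemma ae_distribution d (T : measurableType d) (R : realType)
    (P : probability T R) (X : {RV P >-> R}) (f g : R -> R) :
  measurable_fun setT f -> measurable_fun setT g ->
  {ae distribution P X, forall x, f x = g x} <->
  {ae P, forall w, f (X w) = g (X w)}.
Proof.
move=> mf mg; have mne : measurable [set x | f x != g x].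
  rewrite (_ : [set _ | _] = [set x | f x < g x] `|` [set x | g x < f x]).
    by apply: measurableU; exact: measurable_set_ltr.
  by apply/seteqP; split => x /=; rewrite neq_lt => /orP.
have mneX : measurable [set w | f (X w) != g (X w)].
  exact: (measurable_funPTI X mne).
split=> ae.
- have : (distribution P X).-negligible [set x | f x != g x].
    by apply: negligibleS ae => x /= /eqP.
  rewrite negligibleP// => N0.
  by exists [set w | f (X w) != g (X w)]; split => // w /= /eqP.
- have : P.-negligible [set w | f (X w) != g (X w)].
    by apply: negligibleS ae => w /= /eqP.
  rewrite negligibleP// => N0.
  by exists [set x | f x != g x]; split => // w /= /eqP.
Qed.

Lemma eq_distribution d (T : measurableType d) (R : realType)
    (P : probability T R) (X Y : {RV P >-> R}) (F : R -> R) :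
  has_distribution_function X F -> has_distribution_function Y F ->
  forall A, measurable A -> distribution P X A = distribution P Y A.
Proof.
move=> hX hY A mA.
have mX : measurable_fun [set: T] (X : T -> measurableTypeR R).
  exact: (measurable_funP X).
have mY : measurable_fun [set: T] (Y : T -> measurableTypeR R).
  exact: (measurable_funP Y).
pose X' : {RV P >-> measurableTypeR R} :=
  HB.pack (X : T -> measurableTypeR R)
    (isMeasurableFun.Build _ _ T (measurableTypeR R) _ mX).
pose Y' : {RV P >-> measurableTypeR R} :=
  HB.pack (Y : T -> measurableTypeR R)
    (isMeasurableFun.Build _ _ T (measurableTypeR R) _ mY).
apply: (@eq_probability_cdf R (distribution P X') (distribution P Y') _ A mA) => x.
exact: (etrans (hX x) (esym (hY x))).
Qed.

Theorem theorem6p1 (d : measure_display) (T : measurableType d) (R : realType)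
    (P : probability T R) (X Y : {RV P >-> R}) (F : R -> R) (psi : R -> R)
    (hindep : independent_RV X Y)
    (hX : has_distribution_function X F)
    (hY : has_distribution_function Y F)
    (hF : absolutely_continuous_df F)
    (mpsi : measurable_fun [set: R] psi)
    (hpsi : ('E_P[fun w => psi (X w)] = 0)%E)
    (W : T -> R)
    (hW : is_cond_expectation P (sigma_of X)
            (fun w => psi (Y w) * \1_[set v | Y v < X v] w) W) :
  ('E_P[fun w => (W w ^+ 2)%R]
     <= ((pi ^+ 2)^-1)%R%:E * 'E_P[fun w => (psi (X w) ^+ 2)%R])%E
  /\
  (('E_P[fun w => (W w ^+ 2)%R]
     = ((pi ^+ 2)^-1)%R%:E * 'E_P[fun w => (psi (X w) ^+ 2)%R])%E
   <->
   exists a : R,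
     {ae distribution P X, forall x, psi x = a * cos (pi * F x)}).
Proof.
pose U : T -> R := F \o X; pose psiX : T -> R := psi \o X.
have U01 : uniform01 P U.
  apply: probability_integral_transform => // a b.
  exact: absolutely_continuous_df_continuous.
have ndF : {homo F : x y / x <= y}.
  by move=> x y xy; rewrite -lee_fin -!hX cdf_nondecreasing.
have mF : measurable_fun [set: R] F by exact: nondecreasing_measurable.
have mU : measurable_fun setT U by exact: measurableT_comp.
have mpsiX : measurable_fun setT psiX by exact: measurableT_comp.
have epsiX : (\int[P]_w (psiX w)%:E = 0)%E.
  by move: hpsi; rewrite unlock.
(* an integral equal to 0 is finite, and then so is that of the absolute value *)
have ipsiX : P.-integrable setT (EFin \o psiX).
  apply/integrableP; split; first exact/measurable_EFinP.
  apply/abse_integralP => //; first exact/measurable_EFinP.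
  by rewrite epsiX abse0 ltry.
have XY := eq_distribution hX hY.
have ipsi : (distribution P X).-integrable setT (EFin \o psi).
  apply: integrable_pushforward => //; exact/measurable_EFinP.
have ipsiY : P.-integrable setT (EFin \o (psi \o Y)).
  apply/integrableP; split; first exact/measurable_EFinP/measurableT_comp.
  have /integrableP[_] := ipsi.
  rewrite (@eq_measure_integral _ _ _ _ (distribution P Y)) => [|A mA _].
    by rewrite ge0_integral_distribution//; exact/measurableT_comp/measurable_EFinP.
  exact: XY.
pose G := integral_below P U psiX.
have WG : {ae P, forall w, W w = G w}.
  have := is_cond_expectation_unique hW (cond_expectation_lt hindep mpsi ipsiY).
  apply: filterS => w ->; rewrite /G /integral_below /Rintegral; congr fine.
  rewrite (@eq_measure_integral _ _ _ _ (distribution P X)) => [|A mA _]; last first.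
    exact/esym/XY.
  rewrite integral_pushforward//; last 2 first.
  - exact/measurable_EFinP.
  - apply: (integrableS measurableT _ (@subsetT _ _) ipsiX).
    exact: measurable_funPTI.
  have meq : measurable [set v | U v = U w].
    by have := mU measurableT _ (measurable_set1 (U w)); rewrite setTI.
  have mlt : measurable (X @^-1` `]-oo, X w[%classic) by exact: measurable_funPTI.
  rewrite (negligible_integral meq)//; last 2 first.
  - exact: (integrableS measurableT mlt (@subsetT _ _) ipsiX).
  - exact: uniform01_eq0.
  (* X v < X w and F (X v) < F (X w) differ only on a level set of F \o X *)
  congr (\int[P]_(v in _) _)%E; apply/seteqP; split => v; rewrite /below/= in_itv/=.
    by move=> [vw /eqP ne]; rewrite lt_neqAle ne/= ndF// ltW.
  move=> vw; split; last by move=> /eqP; rewrite lt_eqF.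
  by rewrite ltNge; apply/negP => /ndF; rewrite leNgt vw.
have aeX a : {ae distribution P X, forall x, psi x = a * cos (pi * F x)} <->
    {ae P, forall w, psiX w = a * cos (pi * U w)}.
  apply: (ae_distribution X (g := fun x => a * cos (pi * F x))) => //.
  by apply: (measurable_funM (measurable_cst a)); exact: measurable_cos_pi.
have WG2 : (\int[P]_w (W w ^+ 2)%:E = \int[P]_w (G w ^+ 2)%:E)%E.
  apply: ge0_ae_eq_integral => //.
  - have [_ /measurable_int/measurable_EFinP mW _] := hW.
    by apply/measurable_EFinP/measurable_funX.
  - by apply/measurable_EFinP/measurable_funX; exact: measurable_integral_below.
  - by move=> w _; rewrite lee_fin sqr_ge0.
  - by move=> w _; rewrite lee_fin sqr_ge0.
  - by apply: filterS WG => w /= ->.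
suff [le_ eq_] : (\int[P]_w (G w ^+ 2)%:E <=
      ((pi ^+ 2)^-1)%:E * \int[P]_w (psiX w ^+ 2)%:E)%E /\
    ((\int[P]_w (G w ^+ 2)%:E =
      ((pi ^+ 2)^-1)%:E * \int[P]_w (psiX w ^+ 2)%:E)%E <->
     exists a, {ae P, forall w, psiX w = a * cos (pi * U w)}).
  rewrite unlock WG2; split=> //.
  by split=> [/eq_[a /aeX]|[a /aeX h]]; [exists a|apply/eq_; exists a].
have mpsi2 : measurable_fun setT (fun w => psiX w ^+ 2) by exact: measurable_funX.
(* without square integrability the right-hand side is +oo *)
have [psi2oo|] := ltP (\int[P]_w (psiX w ^+ 2)%:E)%E +oo%E.
  have ipsi2 : P.-integrable setT (EFin \o (fun w => psiX w ^+ 2)).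
    apply/integrableP; split; first exact/measurable_EFinP.
    by under eq_integral do rewrite /= ger0_norm ?sqr_ge0//.
  have psi0 : \int[P]_w psiX w = 0 by rewrite /Rintegral epsiX.
  by split; [exact: uniform_le|exact: uniform_eq].
rewrite leye_eq => /eqP psi2oo.
have G2oo := integral_below_sqr_lty mU ipsiX.
have k0 : (0 < ((pi ^+ 2)^-1)%:E :> \bar R)%E.
  by rewrite lte_fin invr_gt0 exprn_gt0// pi_gt0.
rewrite psi2oo gt0_muley//; split; first exact: leey.
split=> [G2E|[a psiE]]; first by rewrite -/G G2E in G2oo.
suff : (\int[P]_w (psiX w ^+ 2)%:E <= (a ^+ 2)%:E)%E by rewrite psi2oo.
rewrite (@le_trans _ _ (\int[P]_w (a ^+ 2)%:E)%E)//; last first.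
  by rewrite integral_cst// [X in (_ * X)%E]probability_setT mule1.
apply: ae_ge0_le_integral => //.
- by move=> w _; rewrite lee_fin sqr_ge0.
- exact/measurable_EFinP.
- by move=> w _; rewrite lee_fin sqr_ge0.
by apply: filterS psiE => w -> _; rewrite lee_fin exprMn ler_piMr ?sqr_ge0.
Qed.
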